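(* Let $(\theta_t)_{t\ge1}$ be a sequence of random parameters in $\Theta$ such that each $\theta_t$ is $\mathcal{F}_{t-1}$-measurable. Then, for any $\delta\in(0,1)$, $$\mathbb{P}\Big[\exists n\ge1:\ \sum_{t=1}^n d_\psi\big(\langle\theta_t,X_t\rangle,\langle\theta^\star,X_t\rangle\big)\ \ge\ \tfrac12\,\mathrm{regret}_{\theta^n}(\theta^\star)+\log\frac1\delta\Big]\le\delta.$$
   Context: Generalized linear model (GLM). Fix $d\ge1$. Labels take values in a measurable set $\mathcal{Y}\subseteq\mathbb{R}$ equipped with a fixed $\sigma$-finite reference measure $\mathrm{d}y$ (e.g. Lebesgue or counting measure); all densities on $\mathcal{Y}$ are with respect to it. Let $h:\mathcal{Y}\to[0,\infty)$ and let $\psi:\mathbb{R}\to\mathbb{R}$ be convex and differentiable, such that for all $x,\theta\in\mathbb{R}^d$ the function $p(y|x,\theta)=\exp(\langle\theta,x\rangle y-\psi(\langle\theta,x\rangle))h(y)$ is a probability density on $\mathcal{Y}$. The data are random pairs $(X_t,Y_t)_{t\ge1}$ with $X_t\in\mathbb{R}^d$, $Y_t\in\mathcal{Y}$; let $\mathcal{F}_t=\sigma(X_1,Y_1,\dots,X_t,Y_t,X_{t+1})$ and $\mathcal{F}_0=\sigma(X_1)$. Covariates may be chosen adaptively. For a fixed unknown $\theta^\star\in\mathbb{R}^d$ and every $t\ge 1$, the conditional density of $Y_t$ given $\mathcal{F}_{t-1}$ is $p(\cdot|X_t,\theta^\star)$. $\Theta\subseteq\mathbb{R}^d$ is a measurable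 parameter space. Loss: $\ell_t(\theta)=-\langle\theta,X_t\rangle Y_t+\psi(\langle\theta,X_t\rangle)-\log h(Y_t)=-\log p(Y_t|X_t,\theta)$. For $\theta^n=(\theta_1,\dots,\theta_n)$, $\mathrm{regret}_{\theta^n}(\bar\theta)=\sum_{t=1}^n(\ell_t(\theta_t)-\ell_t(\bar\theta))$. Also $d_\psi(z,z')=\tfrac12\psi(z)+\tfrac12\psi(z')-\psi(z/2+z'/2)$. *)

(* Defs.v *)
From HB Require Import structures.
From mathcomp Require Import all_boot all_order all_algebra.
From mathcomp Require Import all_classical all_reals all_analysis.
From mathcomp Require Import measurable_realfun.

Set Implicit Arguments.
Unset Strict Implicit.
Unset Printing Implicit Defensive.

Import Order.TTheory GRing.Theory Num.Theory.
Import numFieldNormedType.Exports.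

Local Open Scope classical_set_scope.
Local Open Scope ring_scope.

(* R^d with its Borel sigma-algebra; the library puts a topology, but no
   measurable structure, on ['rV[R]_d]. *)
Definition rVborel (R : realType) (d : nat) :=
  g_sigma_algebraType (@open 'rV[R]_d).

Definition dotp (R : realType) (d : nat) (u v : 'rV[R]_d) : R :=
  \sum_(i < d) u ord0 i * v ord0 i.

Definition prob_density (R : realType)
    (mu : {measure set R -> \bar R})
    (D : set R) (f : R -> R) : Prop :=
  [/\ measurable_fun D f,
      forall y, D y -> 0 <= f y &
      (\int[mu]_(y in D) (f y)%:E = 1)%E].

(* The conditional density, with respect to mu restricted to D, of a D-valued
   random variable Y given the sigma-algebra generated by G: for every
   measurable B included in D, the function w |-> \int_B p w y dmu(y) is a
   version of P[Y \in B | sigma(G)]. *)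
Definition conditional_density (disp : measure_display)
    (Omega : measurableType disp) (R : realType) (P : probability Omega R)
    (G : set (set Omega))
    (mu : {measure set R -> \bar R})
    (D : set R) (Y : Omega -> R)
    (p : Omega -> R -> R) : Prop :=
  forall B : set R, measurable B -> B `<=` D ->
    measurable_fun [set: g_sigma_algebraType G]
      (fun w => \int[mu]_(y in B) (p w y)%:E)%E /\
    (forall A : set Omega, G.-sigma.-measurable A ->
      P (A `&` Y @^-1` B) = (\int[P]_(w in A) \int[mu]_(y in B) (p w y)%:E)%E).

(* Generators of F_t = sigma(X_1, Y_1, ..., X_t, Y_t, X_{t+1}); the
   sigma-algebra itself is the measurable structure of
   [g_sigma_algebraType (history X Y t)].  Time starts at 1: X 0 and Y 0 are
   never used. *)
Definition history (disp : measure_display) (Omega : measurableType disp)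
    (R : realType) (d : nat) (X : nat -> Omega -> 'rV[R]_d)
    (Y : nat -> Omega -> R) (t : nat) : set (set Omega) :=
  (\bigcup_(s in [set s | (1 <= s <= t.+1)%N])
     preimage_set_system setT (X s) (@measurable _ (rVborel R d))) `|`
  (\bigcup_(s in [set s | (1 <= s <= t)%N])
     preimage_set_system setT (Y s) (@measurable _ R)).

Definition glm_density (R : realType) (d : nat) (psi h : R -> R)
    (x theta : 'rV[R]_d) (y : R) : R :=
  expR (dotp theta x * y - psi (dotp theta x)) * h y.

(* [ln] is total with value 0 at 0, so the loss is real-valued even where
   h y = 0; labels fall in that set with probability 0. *)
Definition glm_loss (R : realType) (d : nat) (psi h : R -> R)
    (x : 'rV[R]_d) (y : R) (theta : 'rV[R]_d) : R :=
  - (dotp theta x * y) + psi (dotp theta x) - ln (h y).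

Definition regret (R : realType) (d : nat) (psi h : R -> R)
    (x : nat -> 'rV[R]_d) (y : nat -> R) (theta : nat -> 'rV[R]_d)
    (n : nat) (thetabar : 'rV[R]_d) : R :=
  \sum_(1 <= t < n.+1)
    (glm_loss psi h (x t) (y t) (theta t) - glm_loss psi h (x t) (y t) thetabar).

Definition d_psi (R : realType) (psi : R -> R) (z z' : R) : R :=
  2^-1 * psi z + 2^-1 * psi z' - psi (z / 2 + z' / 2).

(* Main.v *)
(* Write a_t = <theta_t, X_t>, b_t = <theta^star, X_t> and m_t = (a_t + b_t) / 2.
   The terms in h cancel, and d_psi(a_t, b_t) minus half the t-th regret term is
   (m_t - b_t) Y_t - (psi(m_t) - psi(b_t)), the log-likelihood ratio at Y_t of
   the model with natural parameter m_t against the true one.  Its exponential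
   Z_t has conditional mean 1 given F_(t-1), since the density with parameter m_t
   integrates to 1, so the products Z_1 ... Z_n form a nonnegative martingale,
   and Ville's inequality at level 1 / delta concludes. *)
Require Import Defs.
From HB Require Import structures.
From mathcomp Require Import all_boot all_order all_algebra.
From mathcomp Require Import all_classical all_reals all_analysis.
From mathcomp Require Import measurable_realfun ring.

Set Implicit Arguments.
Unset Strict Implicit.
Unset Printing Implicit Defensive.

Import Order.TTheory GRing.Theory Num.Theory.
Import numFieldNormedType.Exports.

Local Open Scope classical_set_scope.
Local Open Scope ring_scope.

Import HBNNSimple.

(** * Integration against a measure given by a density *)

(** The hypothesis on [nu] settles indicators, additivity over the finite range settles simple
    functions, and monotone convergence along the increasing approximations [h n] of [g] settles the
    rest. *)
Lemma ge0_integral_density d (T : measurableType d) (R : realType)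
    (mu nu : {measure set T -> \bar R}) (q : T -> R) (g : T -> \bar R) :
  measurable_fun setT q -> (forall x, 0 <= q x) ->
  (forall A, measurable A -> nu A = \int[mu]_(x in A) (q x)%:E)%E ->
  measurable_fun setT g -> (forall x, 0 <= g x)%E ->
  (\int[nu]_x g x = \int[mu]_x (g x * (q x)%:E))%E.
Proof.
move=> mq q0 nuE mg g0.
pose h := nnsfun_approx measurableT mg.
have hg x : EFin (h n x) @[n --> \oo] --> g x by exact: cvg_nnsfun_approx.
have ndh x : {homo (fun n => EFin (h n x)) : n m / (n <= m)%N >-> (n <= m)%E}.
  by move=> n m nm; rewrite lee_fin; exact/lefP/nd_nnsfun_approx.
have hE n : (\int[nu]_x (h n x)%:E = \int[mu]_x ((h n x)%:E * (q x)%:E))%E.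
  pose s r x := (r * \1_(h n @^-1` [set r]) x)%R.
  have ms r : measurable_fun setT (s r) by exact: measurable_funM.
  have s0 r x : 0 <= s r x by rewrite -lee_fin nnfun_muleindic_ge0.
  have hs x : ((h n x)%:E = \sum_(r \in range (h n)) (s r x)%:E)%E.
    by rewrite fimfunE -fsumEFin.
  under eq_integral do rewrite hs.
  rewrite ge0_integral_fsum//; last 2 first.
  - by move=> r; exact/measurable_EFinP.
  - by move=> r x _; rewrite lee_fin.
  under [RHS]eq_integral.
    move=> x _; rewrite hs ge0_mule_fsuml; last by move=> r; rewrite lee_fin.
    over.
  rewrite [RHS]ge0_integral_fsum//; last 2 first.
  - move=> r; apply: emeasurable_funM; exact/measurable_EFinP.
  - by move=> r x _; rewrite -EFinM lee_fin mulr_ge0.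
  apply: eq_fsbigr => r /[!inE] -[t _ htr].
  have r0 : 0 <= r by rewrite -htr.
  have mr : measurable (h n @^-1` [set r]) by exact: measurable_sfunP.
  under eq_integral do rewrite EFinM.
  rewrite ge0_integralZl//; last exact/measurable_EFinP.
  rewrite integral_indic// setIT nuE//.
  under [RHS]eq_integral do rewrite EFinM -muleA.
  rewrite ge0_integralZl//; last 2 first.
  - by apply: emeasurable_funM; exact/measurable_EFinP.
  - by move=> x _; rewrite -EFinM lee_fin mulr_ge0.
  rewrite integral_mkcond; congr *%E; apply: eq_integral => x _.
  by rewrite epatch_indic/= muleC.
transitivity (\int[nu]_x limn (fun n => (h n x)%:E))%E.
  by apply: eq_integral => x _; apply/esym/cvg_lim.
rewrite monotone_convergence//; last 2 first.
- by move=> n; exact/measurable_EFinP.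
- by move=> n x _; rewrite lee_fin.
transitivity (\int[mu]_x limn (fun n => (h n x)%:E * (q x)%:E))%E; last first.
  apply: eq_integral => x _; apply/cvg_lim => //.
  exact: cvgeZr (hg x).
rewrite monotone_convergence//; last 3 first.
- by move=> n; apply: emeasurable_funM; exact/measurable_EFinP.
- by move=> n x _; rewrite -EFinM lee_fin mulr_ge0.
- by move=> x _ n m nm; rewrite lee_wpmul2r ?lee_fin//; exact: ndh.
by congr (limn _); apply/funext.
Qed.

(** * Measurability and generated sigma-algebras *)

Lemma g_sigma_measurable_fun d d' (T : measurableType d)
    (T' : measurableType d') (G : set (set T)) (f : T -> T') :
  G `<=` measurable ->
  measurable_fun [set: g_sigma_algebraType G] f ->
  measurable_fun [set: T] f.
Proof.
move=> mG mf _ A mA; have := mf measurableT A mA.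
by apply: smallest_sub => //; exact: sigma_algebra_measurable.
Qed.

Lemma g_sigma_measurable_funS d' (T : pointedType)
    (T' : measurableType d') (G G' : set (set T)) (f : T -> T') :
  G `<=` G' ->
  measurable_fun [set: g_sigma_algebraType G] f ->
  measurable_fun [set: g_sigma_algebraType G'] f.
Proof.
move=> GG' mf _ A mA; have := mf measurableT A mA.
exact: sub_smallest2r.
Qed.

Lemma measurable_dotp d (T : measurableType d) (R : realType) (n : nat)
    (f g : T -> 'rV[R]_n) :
  measurable_fun [set: T] (f : T -> rVborel R n) ->
  measurable_fun [set: T] (g : T -> rVborel R n) ->
  measurable_fun [set: T] (fun w => dotp (f w) (g w)).
Proof.
move=> mf mg.
(* Coordinates are continuous, so they pull open intervals back to open sets, which are the
   generators of [rVborel]. *)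
have mcoord i : measurable_fun [set: rVborel R n] (fun u : 'rV[R]_n => u ord0 i).
  apply: (measurability _ (RGenOpens.measurableE R)).
  move=> _ [_ [a [b ->]] <-]; rewrite setTI; apply: sub_sigma_algebra.
  apply: open_comp; last exact: interval_open.
  by move=> u _; exact: coord_continuous.
apply: measurable_sum => i; apply: measurable_funM.
- exact: (measurableT_comp (mcoord i) mf).
- exact: (measurableT_comp (mcoord i) mg).
Qed.

Lemma derivable_measurable_fun (R : realType) (f : R -> R) :
  (forall x, derivable f x 1) -> measurable_fun setT f.
Proof.
move=> df; apply: continuous_measurable_fun => x.
exact/differentiable_continuous/derivable1_diffP.
Qed.

(** * Disintegration along a conditional density *)

(** [conditional_density] only tests rectangles [A] times [B]; uniqueness of measures on a
    generating pi-system extends it to integrands depending jointly on [w] and [Y w]. The type of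
    [g] makes its dependence on [w] measurable for the sigma-algebra generated by [G]. *)
Lemma ge0_integral_conditional_density disp (Omega : measurableType disp)
    (R : realType) (P : probability Omega R) (G : set (set Omega))
    (mu : {sigma_finite_measure set R -> \bar R}) (D : set R)
    (Y : Omega -> R) (p : Omega -> R -> R)
    (g : g_sigma_algebraType G * R -> \bar R) :
  G `<=` measurable -> measurable D -> measurable_fun setT Y ->
  (forall w, D (Y w)) -> conditional_density P G mu D Y p ->
  (forall w y, D y -> 0 <= p w y) ->
  measurable_fun setT
    (fun z : g_sigma_algebraType G * R => (p z.1 \_ D) z.2) ->
  measurable_fun setT g -> (forall z, 0 <= g z)%E ->
  (\int[P]_w g (w, Y w) =
   \int[P]_w \int[mu]_(y in D) (g (w, y) * (p w y)%:E))%E.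
Proof.
move=> mG mD mY DY pY p0 mp mg g0.
(* The identity, viewed as a map into the coarser sigma-algebra: its law [P1] is [P] restricted to
   that sigma-algebra. *)
pose toG : Omega -> g_sigma_algebraType G := id.
have mtoG : measurable_fun setT toG.
  by apply: (g_sigma_measurable_fun (f := toG) mG); exact: measurable_id.
pose jY (w : Omega) : g_sigma_algebraType G * R := (w, Y w).
have mjY : measurable_fun setT jY by exact: measurable_fun_pair.
(* Extension by 0 outside [D] makes the density nonnegative everywhere and lets the product be taken
   with [mu] on all of [R]. *)
pose q (z : g_sigma_algebraType G * R) := (p z.1 \_ D) z.2.
have q0 z : 0 <= q z.
  by rewrite /q /patch; case: ifPn => // /[!inE] /p0.
pose X1 : {mfun Omega >-> g_sigma_algebraType G} :=
  HB.pack toG (isMeasurableFun.Build _ _ _ _ _ mtoG).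
pose X2 : {mfun Omega >-> (g_sigma_algebraType G * R)%type} :=
  HB.pack jY (isMeasurableFun.Build _ _ _ _ _ mjY).
pose P1 : {sigma_finite_measure set (g_sigma_algebraType G) -> \bar R} :=
  distribution P X1.
pose nu1 := distribution P X2.
pose P1mu := (P1 \x mu)%E.
have mqE : measurable_fun setT (EFin \o q) by exact/measurable_EFinP.
(* [nu1] is the law of [(w, Y w)], [nu2] has density [q] with respect to
   [P1 \x mu]; they agree on rectangles, hence everywhere. *)
pose nu2 A := (\int[P1mu]_(z in A) (q z)%:E)%E.
have nu2_0 : nu2 set0 = 0%E by rewrite /nu2 integral_set0.
have nu2_ge0 A : (0 <= nu2 A)%E.
  by apply: integral_ge0 => z _; rewrite lee_fin.
have nu2_sa : semi_sigma_additive nu2.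
  by apply: (@semi_sigma_additive_nng_induced _ _ _ P1mu (EFin \o q)).
pose nu2' : {measure set (g_sigma_algebraType G * R) -> \bar R} :=
  HB.pack nu2 (isMeasure.Build _ _ _ nu2 nu2_0 nu2_ge0 nu2_sa).
have rectE A B : G.-sigma.-measurable A -> measurable B ->
    nu1 (A `*` B) = nu2' (A `*` B).
  move=> mA mB.
  (* The conditional density is tested only inside [D]; since [Y] takes its values there, replacing
     [B] by its trace on [D] leaves the event unchanged. *)
  have mBD : measurable (B `&` D) by exact: measurableI.
  have [mF PF] := pY (B `&` D) mBD (@subIsetr _ _ _).
  transitivity (P (A `&` Y @^-1` (B `&` D))).
    rewrite /nu1 /distribution /pushforward; congr (P _).
    by apply/seteqP; split=> w /= [Aw] => [Bw|[Bw _]].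
  rewrite PF//= /nu2 [RHS]integral_mkcond fubini_tonelli1; last 2 first.
  - apply/(measurable_restrictT _ (measurableX mA mB)).
    exact: measurable_funTS.
  - by move=> z; apply: erestrict_ge0 => z' _; rewrite lee_fin.
  transitivity (\int[P1]_(w in A) \int[mu]_(y in B `&` D) (p w y)%:E)%E.
    rewrite ge0_integral_pushforward//.
    - exact: measurable_funTS.
    - move=> w _; apply: integral_ge0 => y [_ Dy].
      by rewrite lee_fin p0.
  rewrite integral_mkcond; apply: eq_integral => w _.
  rewrite /fubini_F /patch; case: ifPn => wA.
    rewrite [LHS]integral_mkcond; apply: eq_integral => y _.
    rewrite /patch /q /patch in_setI in_setX/= wA/=.
    by case: ifPn => [/andP[-> ->]//|]; case: (y \in B) => //= /negbTE ->.
  rewrite integral0_eq// => y _.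
  by rewrite in_setX/= (negbTE wA).
have nuE A : measurable A -> (nu1 A = \int[P1mu]_(z in A) (q z)%:E)%E.
  move=> mA.
  pose rect := [set A `*` B | A in @measurable _ (g_sigma_algebraType G) &
                             B in @measurable _ R].
  apply: (measure_unique rect (fun=> setT) _ _ _ _ nu1 nu2') => //.
  - exact: measurable_prod_measurableType.
  - move=> _ _ [A1 mA1 [B1 mB1 <-]] [A2 mA2 [B2 mB2 <-]].
    exists (A1 `&` A2); first exact: measurableI.
    by exists (B1 `&` B2); [exact: measurableI|rewrite setXI].
  - by move=> _; exists setT => //; exists setT => //; rewrite setXTT.
  - by rewrite bigcup_const.
  - by move=> _ [A1 mA1 [B1 mB1 <-]]; exact: rectE.
  - by move=> _; rewrite (le_lt_trans (probability_le1 _ _))// ltry.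
(* Pass to the law [nu1], insert its density [q], apply Tonelli, then pull [P1] back to [P] along
   [toG]. *)
transitivity (\int[nu1]_z g z)%E.
  by rewrite ge0_integral_distribution.
rewrite (@ge0_integral_density _ _ _ _ _ q _ mp q0 nuE mg g0).
rewrite fubini_tonelli1; last 2 first.
- by apply: emeasurable_funM => //; exact/measurable_EFinP.
- by move=> z; rewrite mule_ge0 ?lee_fin.
rewrite ge0_integral_pushforward;
  [|exact: mtoG|exact: measurableT| |]; last 2 first.
- apply: measurable_fun_fubini_tonelli_F => //.
  + by apply: emeasurable_funM => //; exact/measurable_EFinP.
  + by move=> z; rewrite mule_ge0 ?lee_fin.
- by move=> w _; apply: integral_ge0 => y _; rewrite mule_ge0 ?lee_fin.
apply: eq_integral => w _ /=.
rewrite /fubini_F [RHS]integral_mkcond; apply: eq_integral => y _.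
by rewrite /q /patch/=; case: ifPn => // _; rewrite mule0.
Qed.

(** * Ville's inequality for products of nonnegative factors *)

Section ville.
Context disp (Omega : measurableType disp) (R : realType)
  (P : probability Omega R).
Variables (F : nat -> set (set Omega)) (Z : nat -> Omega -> R).
(** [Z_le1] is the supermartingale condition E[[Z n] | [F n]] <= 1 in integrated form, tested
    against nonnegative [F n]-measurable weights. The factor [Z n] is revealed only at stage
    [n.+1]. *)
Hypotheses (mF : forall n, F n `<=` measurable)
  (ndF : forall n, F n `<=` F n.+1)
  (Z_ge0 : forall n w, 0 <= Z n w)
  (mZ : forall n, measurable_fun [set: g_sigma_algebraType (F n.+1)] (Z n))
  (Z_le1 : forall n (f : Omega -> R), (forall w, 0 <= f w) ->
    measurable_fun [set: g_sigma_algebraType (F n)] f ->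
    (\int[P]_w (f w * Z n w)%:E <= \int[P]_w (f w)%:E)%E).

(* The partial products of [Z], frozen once they reach [c]: the stopped process
   is again a supermartingale, and its events [c <= stopped c n] increase. *)
Fixpoint stopped (c : R) (n : nat) (w : Omega) : R :=
  if n is m.+1 then
    if c <= stopped c m w then stopped c m w else stopped c m w * Z m w
  else 1.

Lemma stopped_ge0 c n w : 0 <= stopped c n w.
Proof. by elim: n => //= n ih; case: ifP => // _; rewrite mulr_ge0. Qed.

Lemma measurable_stopped c n :
  measurable_fun [set: g_sigma_algebraType (F n)] (stopped c n).
Proof.
elim: n => [|n ih] /=; first exact: measurable_cst.
have {}ih := g_sigma_measurable_funS (@ndF n) ih.
by apply: measurable_fun_ifT => //;
  [exact: measurable_fun_ler|exact: measurable_funM].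
Qed.

Lemma measurable_stoppedT c n : measurable_fun [set: Omega] (stopped c n).
Proof. exact: (g_sigma_measurable_fun (@mF n) (@measurable_stopped c n)). Qed.

(** Split the process at stage [n] into its frozen part [s1] and its running part [s2]. Only [s2]
    gets multiplied by [Z n], and [Z_le1] with weight [s2] shows that the expectation does not
    increase. *)
Lemma integral_stopped_le1 c n : (\int[P]_w (stopped c n w)%:E <= 1)%E.
Proof.
elim: n => [|n ih] /=.
  by rewrite integral_cst//= mul1e probability_setT.
apply: le_trans ih.
pose S := stopped c n.
pose s1 w := if c <= S w then S w else 0.
pose s2 w := if c <= S w then 0 else S w.
have S0 w : 0 <= S w := stopped_ge0 c n w.
have s10 w : 0 <= s1 w by rewrite /s1; case: ifP.
have s20 w : 0 <= s2 w by rewrite /s2; case: ifP.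
have mS := @measurable_stopped c n.
have ms1 : measurable_fun [set: g_sigma_algebraType (F n)] s1.
  by apply: measurable_fun_ifT => //; exact: measurable_fun_ler.
have ms2 : measurable_fun [set: g_sigma_algebraType (F n)] s2.
  by apply: measurable_fun_ifT => //; exact: measurable_fun_ler.
have ms1T := g_sigma_measurable_fun (@mF n) ms1.
have mZT := g_sigma_measurable_fun (@mF n.+1) (@mZ n).
have ms2T := g_sigma_measurable_fun (@mF n) ms2.
under eq_integral.
  move=> w _; rewrite -/S.
  rewrite (_ : (if _ then _ else _) = s1 w + s2 w * Z n w); last first.
    by rewrite /s1 /s2; case: ifP => _; rewrite ?mul0r ?addr0 ?add0r.
  rewrite EFinD; over.
rewrite ge0_integralD//; last 4 first.
- by move=> w _; rewrite lee_fin.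
- exact/measurable_EFinP.
- by move=> w _; rewrite lee_fin mulr_ge0.
- by apply/measurable_EFinP; exact: measurable_funM.
apply: (le_trans (leeD (le_refl _) (Z_le1 s20 ms2))).
rewrite -ge0_integralD//; last 4 first.
- by move=> w _; rewrite lee_fin.
- exact/measurable_EFinP.
- by move=> w _; rewrite lee_fin.
- exact/measurable_EFinP.
rewrite le_eqVlt; apply/orP; left; apply/eqP; apply: eq_integral => w _.
by rewrite -EFinD /s1 /s2 -/S; case: ifP => _; rewrite ?addr0 ?add0r.
Qed.

(** Before freezing, the process is the partial product; once frozen, the index of freezing is the
    witness [m]. This translates between crossings by the products and crossings by [stopped]. *)
Lemma stoppedP c n w : stopped c n w = \prod_(k < n) Z k w \/
  c <= stopped c n w /\ exists m, c <= \prod_(k < m) Z k w.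
Proof.
elim: n => [|n ih] /=; first by left; rewrite big_ord0.
case: ifPn => [cS|cS].
  case: ih => [SE|[_ ?]]; right; split=> //.
  by exists n; rewrite -SE.
case: ih => [SE|[cS' _]]; last by rewrite cS' in cS.
by left; rewrite big_ord_recr /= SE.
Qed.

(** The crossing event is the increasing union of the events [A n]. Markov's inequality bounds each
    of them by the inverse of [c], and continuity from below carries the bound to the union. *)
Lemma ville_inequality (c : R) : 0 < c ->
  (P [set w | exists n, (c <= \prod_(k < n) Z k w)%R] <= (c^-1)%:E)%E.
Proof.
move=> c0.
pose A n := [set w | c <= stopped c n w].
have mA n : measurable (A n).
  rewrite (_ : A n = stopped c n @^-1` `[c, +oo[%classic); last first.
    by apply/seteqP; split=> w /=; rewrite in_itv/= andbT.
  by rewrite -[X in measurable X]setTI; exact: measurable_stoppedT.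
have ndA : {homo A : n m / (n <= m)%N >-> (n <= m)%O}.
  apply: homo_leq => // [x y z|n]; first exact: le_trans.
  by apply/subsetPset => w; rewrite /A /= => cS; rewrite cS.
have -> : [set w | exists n, (c <= \prod_(k < n) Z k w)%R] = \bigcup_n A n.
  apply/seteqP; split=> w /= => [[n cZ]|[n _ cS]].
    by exists n => //; rewrite /A /=; case: (stoppedP c n w) => [->|[]].
  by case: (stoppedP c n w) => [SE|[_ //]]; exists n; rewrite -SE.
have mUA : measurable (\bigcup_n A n) by exact: bigcup_measurable.
apply: (cvge_le _ (nondecreasing_cvg_mu mA mUA ndA)).
apply: nearW => n /=.
rewrite -[leRHS]mule1 lee_pdivlMl//.
apply: le_trans (integral_stopped_le1 c n).
have -> : A n = [set w | (c%:E <= `|(stopped c n w)%:E|)%E].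
  by apply/seteqP; split=> w /=; rewrite lee_fin ger0_norm ?stopped_ge0.
rewrite -[X in P X]setTI.
under eq_integral.
  move=> w _; rewrite -[(stopped c n _)%:E]gee0_abs ?lee_fin ?stopped_ge0//.
  over.
(* Markov's inequality, with the identity as comparison function. *)
apply: (@le_integral_comp_abse _ _ _ P _ measurableT
  (EFin \o stopped c n) c id) => //.
by apply/measurable_EFinP; exact: measurable_stoppedT.
Qed.

End ville.

(** * Likelihood ratios in the generalized linear model *)

(** The exponential factor turns the density with parameter [b w] into the one with parameter [m w],
    so integrating out [Y] leaves a total mass of 1. As everything is nonnegative, the equality
    holds even when both sides are infinite. *)
Lemma integral_tilted_density disp (Omega : measurableType disp)
    (R : realType) (P : probability Omega R) (G : set (set Omega))
    (mu : {sigma_finite_measure set R -> \bar R}) (D : set R)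
    (psi h : R -> R) (Y b m f : Omega -> R) :
  G `<=` measurable -> measurable D -> measurable_fun setT Y ->
  (forall w, D (Y w)) -> (forall y, D y -> 0 <= h y) ->
  measurable_fun setT psi ->
  (forall z, prob_density mu D (fun y => expR (z * y - psi z) * h y)) ->
  conditional_density P G mu D Y
    (fun w y => expR (b w * y - psi (b w)) * h y) ->
  measurable_fun [set: g_sigma_algebraType G] b ->
  measurable_fun [set: g_sigma_algebraType G] m ->
  measurable_fun [set: g_sigma_algebraType G] f -> (forall w, 0 <= f w) ->
  (\int[P]_w
     (f w * expR ((m w - b w) * Y w - (psi (m w) - psi (b w))))%:E =
   \int[P]_w (f w)%:E)%E.
Proof.
move=> mG mD mY DY h0 mpsi dens pY mb mm mf f0.
(* At parameter 0 the density is [h] times the constant exp(-psi(0)), so multiplying by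
   [expR (psi 0)] recovers [h]. *)
have mhD : measurable_fun D h.
  have [+ _ _] := dens 0; move=> mh.
  have := @measurable_funM _ _ _ D _ _ (measurable_cst (expR (psi 0))) mh.
  apply: eq_measurable_fun => y _ /=.
  by rewrite mulrA mul0r add0r -expRD subrr expR0 mul1r.
pose T := (g_sigma_algebraType G * R)%type.
have m1 (u : Omega -> R) : measurable_fun [set: g_sigma_algebraType G] u ->
    measurable_fun [set: T] (fun z : T => u z.1).
  by move=> mu'; exact: (measurableT_comp mu' measurable_fst).
have m2 : measurable_fun [set: T] (fun z : T => z.2) by exact: measurable_snd.
pose g (z : T) :=
  (f z.1 * expR ((m z.1 - b z.1) * z.2 - (psi (m z.1) - psi (b z.1))))%:E.
have mpsib := measurableT_comp mpsi mb.
have mpsim := measurableT_comp mpsi mm.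
have mg : measurable_fun setT g.
  apply/measurable_EFinP; apply: measurable_funM; first exact: m1.
  apply: measurableT_comp => //; apply: measurable_funB.
    by apply: measurable_funM => //; apply: measurable_funB; exact: m1.
  by apply: measurable_funB; [exact: (m1 _ mpsim)|exact: (m1 _ mpsib)].
have g0 z : (0 <= g z)%E.
  by rewrite lee_fin mulr_ge0 ?expR_ge0//; exact: f0.
have mp : measurable_fun [set: T]
    (fun z : T => ((fun y => expR (b z.1 * y - psi (b z.1)) * h y) \_ D) z.2).
  rewrite [X in measurable_fun _ X](_ : _ =
      (fun z : T => expR (b z.1 * z.2 - psi (b z.1)) * (h \_ D) z.2)); last first.
    apply/funext => z; rewrite /patch; case: ifP => // _.
    by rewrite mulr0.
  apply: measurable_funM.
    apply: measurableT_comp => //; apply: measurable_funB.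
      by apply: measurable_funM => //; exact: m1.
    exact: (m1 _ mpsib).
  by apply: (measurableT_comp _ m2); exact/(measurable_restrictT _ mD).
transitivity (\int[P]_w g (w, Y w))%E => //.
rewrite (ge0_integral_conditional_density mG mD mY DY pY _ mp mg g0); last first.
  by move=> w y Dy; rewrite mulr_ge0 ?expR_ge0 ?h0.
apply: eq_integral => w _.
have [mdens dens0 dens1] := dens (m w).
transitivity ((f w)%:E * \int[mu]_(y in D)
    (expR (m w * y - psi (m w)) * h y)%:E)%E; last by rewrite dens1 mule1.
rewrite -ge0_integralZl; last 4 first.
- exact: mD.
- exact/measurable_EFinP.
- by move=> y Dy; rewrite lee_fin dens0.
- by rewrite lee_fin.
apply: eq_integral => y _; rewrite /g/= -!EFinM; congr EFin.
rewrite -mulrA; congr *%R; rewrite mulrA -expRD; congr (expR _ * _).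
ring.
Qed.

Theorem theorem2p4 (R : realType) (d : nat) (d_ge1 : (1 <= d)%N)
    (Yset : set R) (mYset : measurable Yset)
    (mu : {sigma_finite_measure set R -> \bar R})
    (h : R -> R) (h_ge0 : forall y, Yset y -> 0 <= h y)
    (psi : R -> R) (psi_convex : convex_function (E := R^o) setT psi)
    (psi_diff : forall z : R, derivable psi z 1)
    (glm_prob : forall x theta : 'rV[R]_d,
      prob_density mu Yset (glm_density psi h x theta))
    (disp : measure_display) (Omega : measurableType disp)
    (P : probability Omega R)
    (X : nat -> Omega -> 'rV[R]_d) (Y : nat -> Omega -> R)
    (mX : forall t, (1 <= t)%N ->
      measurable_fun [set: Omega] (X t : Omega -> rVborel R d))
    (mY : forall t, (1 <= t)%N ->
      measurable_fun [set: Omega] (Y t))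
    (Y_in : forall t, (1 <= t)%N -> forall w, Yset (Y t w))
    (thetastar : 'rV[R]_d)
    (Y_cond : forall t, (1 <= t)%N ->
      conditional_density P (history X Y t.-1) mu Yset (Y t)
        (fun w => glm_density psi h (X t w) thetastar))
    (Theta : set 'rV[R]_d) (mTheta : @measurable _ (rVborel R d) Theta)
    (theta : nat -> Omega -> 'rV[R]_d)
    (theta_in : forall t, (1 <= t)%N -> forall w, Theta (theta t w))
    (theta_meas : forall t, (1 <= t)%N ->
      measurable_fun [set: g_sigma_algebraType (history X Y t.-1)]
        (theta t : Omega -> rVborel R d))
    (delta : R) (delta01 : 0 < delta < 1) :
  (P [set w | exists2 n : nat, (1 <= n)%N &
        (\sum_(1 <= t < n.+1)
           d_psi psi (dotp (theta t w) (X t w)) (dotp thetastar (X t w))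
         >= 2^-1 * regret psi h (fun t => X t w) (fun t => Y t w)
                     (fun t => theta t w) n thetastar
            + ln (1 / delta))%R]
   <= delta%:E)%E.
Proof.
have psi_m := derivable_measurable_fun psi_diff.
(* As [d] is at least 1, there is a unit vector [e], and every real [z] is the inner product of
   [z *: e] and [e]. Hence the midpoint parameter [m] below also gives a probability density. *)
have densE z : prob_density mu Yset (fun y => expR (z * y - psi z) * h y).
  pose e : 'rV[R]_d := delta_mx ord0 (Ordinal d_ge1).
  have dotpE : dotp (z *: e) e = z.
    rewrite /dotp (bigD1 (Ordinal d_ge1))//= big1 ?addr0.
      by rewrite !mxE !eqxx !mulr1.
    by move=> i /negbTE ine; rewrite !mxE ine andbF !mulr0.
  by have := glm_prob e (z *: e); rewrite /glm_density dotpE.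
pose F := history X Y.
pose a t w := dotp (theta t w) (X t w).
pose b t w := dotp thetastar (X t w).
pose m t w := a t w / 2 + b t w / 2.
(* Shift by one: [Z n] is the factor of time [n.+1], whose covariate and parameter are already
   [F n]-measurable, and the product over [k < n] covers times 1 to [n]. *)
pose Z n w := expR ((m n.+1 w - b n.+1 w) * Y n.+1 w -
                    (psi (m n.+1 w) - psi (b n.+1 w))).
have mF n : F n `<=` measurable.
  move=> A [[s /= /andP[s1 _]]|[s /= /andP[s1 _]]] [B mB <-].
    exact: mX.
  exact: mY.
have ndF n : F n `<=` F n.+1.
  move=> A [[s /= /andP[s1 sn]]|[s /= /andP[s1 sn]]] XA; [left|right];
    by exists s => //=; rewrite s1 (leq_trans sn).
have mXF n : measurable_fun [set: g_sigma_algebraType (F n)]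
    (X n.+1 : Omega -> rVborel R d).
  move=> _ B mB; apply: sub_sigma_algebra; left; exists n.+1 => //=.
  by exists B.
have mYF n : measurable_fun [set: g_sigma_algebraType (F n.+1)] (Y n.+1).
  move=> _ B mB; apply: sub_sigma_algebra; right; exists n.+1 => //=.
  by exists B.
have mb n : measurable_fun [set: g_sigma_algebraType (F n)] (b n.+1).
  by apply: measurable_dotp => //; exact: measurable_cst.
have mm n : measurable_fun [set: g_sigma_algebraType (F n)] (m n.+1).
  apply: measurable_funD; apply: measurable_funM => //.
  by apply: measurable_dotp => //; exact: (theta_meas n.+1).
have Z0 n w : 0 <= Z n w by exact: expR_ge0.
have mZ n : measurable_fun [set: g_sigma_algebraType (F n.+1)] (Z n).
  have mb' := g_sigma_measurable_funS (ndF n) (mb n).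
  have mm' := g_sigma_measurable_funS (ndF n) (mm n).
  apply: measurableT_comp => //; apply: measurable_funB.
    by apply: measurable_funM => //; exact: measurable_funB.
  by apply: measurable_funB; exact: (measurableT_comp psi_m).
have Z_le1 n (f : Omega -> R) : (forall w, 0 <= f w) ->
    measurable_fun [set: g_sigma_algebraType (F n)] f ->
    (\int[P]_w (f w * Z n w)%:E <= \int[P]_w (f w)%:E)%E.
  move=> f0 mf.
  by rewrite (integral_tilted_density (mF n) mYset (mY n.+1 isT)
    (Y_in n.+1 isT) h_ge0 psi_m densE (Y_cond n.+1 isT) (mb n) (mm n) mf f0).
have /andP[d0 d1] := delta01.
have /= := ville_inequality mF ndF Z0 mZ Z_le1 (c := delta^-1).
rewrite invr_gt0 invrK => /(_ d0); apply: le_trans.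
rewrite le_eqVlt; apply/orP; left; apply/eqP; congr (P _).
have eventE n w : (delta^-1 <= \prod_(k < n) Z k w) =
    (\sum_(1 <= t < n.+1) d_psi psi (a t w) (b t w) >=
     2^-1 * regret psi h (fun t => X t w) (fun t => Y t w)
       (fun t => theta t w) n thetastar + ln (1 / delta)).
  have -> : \prod_(k < n) Z k w =
      expR (\sum_(1 <= t < n.+1) d_psi psi (a t w) (b t w) -
        2^-1 * regret psi h (fun t => X t w) (fun t => Y t w)
          (fun t => theta t w) n thetastar).
    rewrite /regret mulr_sumr -sumrB big_add1 big_mkord expR_sum.
    apply: eq_bigr => k _; rewrite /Z /d_psi /glm_loss.
    rewrite -/(m _ _) -/(a _ _) -/(b _ _).
    by congr expR; rewrite /m; field.
  rewrite div1r -[in LHS](lnK (x := delta^-1)) ?posrE ?invr_gt0// ler_expR.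
  by rewrite lerBrDl.
apply/seteqP; split=> w /= [n].
  by move=> _; rewrite -eventE; exists n.
(* Ville's event also allows [n = 0], where the empty product 1 stays below the inverse of [delta]
   because [delta < 1]. *)
case: n => [|n].
  by rewrite big_ord0 invf_le1// leNgt d1.
by rewrite eventE; exists n.+1.
Qed.
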